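(* For every integer $\Delta\geq 1$, $L(K_{\Delta+1})$ has a proper Galvin orientation with respect to $f(\Delta+1)$, where $$f(\Delta+1)= \left\lfloor\frac{3\Delta}{2}\right\rfloor +\begin{cases} 0 & \text{if } \Delta+1\equiv 0 \pmod 4,\\ 1 & \text{if } \Delta+1\equiv 1 \pmod 4,\\ 2 & \text{if } \Delta+1\equiv 2 \pmod 4,\\ 1 & \text{if } \Delta+1\equiv 3 \pmod 4.\end{cases}$$
   Context: A $k$-edge-colouring is an assignment of colours from $\{1,\dots,k\}$ to edges so that adjacent edges get different colours. The line graph $L(G)$ has vertex set $E(G)$, and two edges $e,f$ of $G$ are joined in $L(G)$ by as many edges as the number of ends they share in $G$; each edge of $L(G)$ corresponds to a common incidence of its two ends at a vertex of $G$. Given a partition of $V(G)$ into sets $U$ and $D$ and a $k$-edge-colouring $\varphi$ of $G$, the Galvin orientation of $L(G)$ is defined as follows: for an edge of $L(G)$ with ends $e_1,e_2$, where $\varphi(e_1)<\varphi(e_2)$, corresponding to a common incidence at a vertex $x$ of $G$: if $x\in D$ it is oriented from $e_2$ to $e_1$, and if $x\in U$ it is oriented from $e_1$ to $e_2$. A kernel of a digraph is an independent set $K$ such that every vertex outside $K$ has an out-edge into $K$; a digraph is kernel-perfect if every induced subdigraph has a kernel. The Galvin orientation is proper if it is kernel-perfect and every vertex has outdegree at most $k-1$. $L(G)$ has a proper Galvin orientation with respect to $k$ if there exist a partition $(U,D)$ of $V(G)$ and a $k$-edge-colouring $\varphi$ of $G$ whose Galvin orientation is proper. *)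

(* Defs.v *)
From mathcomp Require Import all_boot.

Set Implicit Arguments.
Unset Strict Implicit.
Unset Printing Implicit Defensive.

(* Finite loopless multigraphs: parallel edges are distinct elements of [edge]
   with the same two-element set of ends. *)
Record multigraph (V : finType) := Multigraph {
  edge : finType;
  ends : edge -> {set V};
  card_ends : forall e, #|ends e| = 2 }.

Definition complete_graph (V : finType) : multigraph V :=
  @Multigraph V {e : {set V} | #|e| == 2} val (fun e => eqP (valP e)).

Definition adjacent_edges (V : finType) (G : multigraph V) (e f : edge G) :=
  (e != f) && (ends e :&: ends f != set0).

Definition edge_colouring (V : finType) (G : multigraph V) (k : nat)
    (phi : edge G -> nat) : Prop :=
  (forall e, 1 <= phi e <= k) /\
  (forall e f, adjacent_edges e f -> phi e != phi f).

(* An edge of the line graph is a pair ({e, f}, x), where e and f are distinct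
   edges of G that are both incident with the vertex x; thus e and f are joined
   by exactly as many edges as the number of ends they share. *)
Definition line_edge (V : finType) (G : multigraph V) : finType :=
  {a : {set edge G} * V |
    (#|a.1| == 2) && [forall e in a.1, a.2 \in ends e]}.

Definition line_ends (V : finType) (G : multigraph V) (a : line_edge G) :
  {set edge G} := (val a).1.

Definition incidence (V : finType) (G : multigraph V) (a : line_edge G) : V :=
  (val a).2.

Lemma card_line_ends (V : finType) (G : multigraph V) (a : line_edge G) :
  #|line_ends a| = 2.
Proof. by have /andP[/eqP] := valP a. Qed.

Definition line_graph (V : finType) (G : multigraph V) : multigraph (edge G) :=
  @Multigraph (edge G) (line_edge G) (@line_ends V G) (@card_line_ends V G).

(* An orientation of H is a digraph whose arcs are the edges of H. *)
Record orientation (V : finType) (H : multigraph V) := Orientation {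
  arc_tail : edge H -> V;
  arc_head : edge H -> V;
  ends_arc : forall a, ends a = [set arc_tail a; arc_head a] }.

Section Digraph.
Variables (V : finType) (H : multigraph V) (o : orientation H).

Definition outdegree (v : V) : nat := #|[set a | arc_tail o a == v]|.

Definition independent (K : {set V}) : Prop :=
  forall a, ~~ ((arc_tail o a \in K) && (arc_head o a \in K)).

(* K is a kernel of the subdigraph induced by W. *)
Definition induced_kernel (W K : {set V}) : Prop :=
  [/\ K \subset W, independent K &
      forall v, v \in W :\: K -> exists a, arc_tail o a = v /\ arc_head o a \in K].

Definition kernel_perfect : Prop :=
  forall W : {set V}, exists K : {set V}, induced_kernel W K.

End Digraph.

(* The parts U and D are allowed to be empty. *)
Definition vertex_bipartition (V : finType) (U D : {set V}) : Prop :=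
  U :|: D = [set: V] /\ [disjoint U & D].

(* When phi is an edge colouring and (U, D) partitions V, exactly one
   orientation of the line graph satisfies this. *)
Definition galvin_orientation (V : finType) (G : multigraph V) (U D : {set V})
    (phi : edge G -> nat) (o : orientation (line_graph G)) : Prop :=
  forall a : line_edge G,
    (incidence a \in D -> phi (arc_head o a) < phi (arc_tail o a)) /\
    (incidence a \in U -> phi (arc_tail o a) < phi (arc_head o a)).

Definition proper_orientation (V : finType) (H : multigraph V) (k : nat)
    (o : orientation H) : Prop :=
  kernel_perfect o /\ forall v, outdegree o v <= k - 1.

Definition has_proper_galvin_orientation (V : finType) (G : multigraph V)
    (k : nat) : Prop :=
  exists (U D : {set V}) (phi : edge G -> nat)
         (o : orientation (line_graph G)),
    [/\ vertex_bipartition U D, edge_colouring k phi,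
        galvin_orientation U D phi o & proper_orientation k o].

Definition f (n : nat) : nat :=
  3 * (n - 1) %/ 2 +
  match n %% 4 with
  | 0 => 0
  | 1 => 1
  | 2 => 2
  | _ => 1
  end.

(* Main.v *)
Require Import Defs.
From mathcomp Require Import all_boot zify.

(** Split the vertices into halves D and U, of nearly equal sizes, with |D|
    even.  Give the edges inside D the smallest colours, the edges between D
    and U the middle ones, and the edges inside U the largest ones.  An edge
    inside D of least colour, or inside U of greatest colour, is a sink, so
    kernels are found greedily until only edges between D and U remain; for
    these Galvin's argument for bipartite graphs applies.  An edge of colour c
    has outdegree at most c - 1 at an end in D and at most k - c at an end in U;
    as colours inside D are at most (k + 1) / 2 and those inside U at least
    (k + 1) / 2, all outdegrees are at most k - 1. *)

Set Implicit Arguments.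
Unset Strict Implicit.
Unset Printing Implicit Defensive.

(** * Kernels found from the colouring alone *)

Section GalvinOrientation.
Variables (V : finType) (G : multigraph V) (D : {set V}) (k : nat).
Variable phi : edge G -> nat.
Hypothesis colouring : edge_colouring k phi.

(** The Galvin arc from [e] to [g] at [x], with U the complement of [D]; stated on colours so that
    kernels can be sought before an orientation is fixed. *)
Definition prefers (x : V) (g e : edge G) : bool :=
  if x \in D then phi g < phi e else phi e < phi g.

Definition dominated (e g : edge G) : bool :=
  [exists x in ends e :&: ends g, prefers x g e].

Lemma dominatedP (e g : edge G) :
  reflect (exists x, [/\ x \in ends e, x \in ends g & prefers x g e])
          (dominated e g).
Proof.
apply: (iffP exists_inP) => [[x]|[x [xe xg p]]].
  by rewrite inE => /andP[xe xg] p; exists x.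
by exists x => //; rewrite inE xe.
Qed.

Lemma adjacent_edgesP (e g : edge G) :
  reflect (e <> g /\ exists x, x \in ends e /\ x \in ends g)
          (adjacent_edges e g).
Proof.
apply: (iffP andP) => [[/eqP ne /set0Pn[x]]|[ne [x [xe xg]]]].
  by rewrite inE => /andP[xe xg]; split=> //; exists x.
by split; [apply/eqP | apply/set0Pn; exists x; rewrite inE xe].
Qed.

Lemma adjacent_edgesC (e g : edge G) : adjacent_edges e g = adjacent_edges g e.
Proof. by rewrite /adjacent_edges eq_sym setIC. Qed.

Lemma colour_inj_at (x : V) (e g : edge G) :
  x \in ends e -> x \in ends g -> phi e = phi g -> e = g.
Proof.
move=> xe xg E; apply/eqP/negPn/negP => /eqP ne.
have /adjacent_edgesP/colouring.2 : e <> g /\ exists x, x \in ends e /\ x \in ends g.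
  by split=> //; exists x.
by rewrite E eqxx.
Qed.

(** A kernel of the subdigraph induced by [W], phrased on the edges of [G]. *)
Definition stable_in (W K : {set edge G}) : Prop :=
  [/\ K \subset W,
      forall e g, e \in K -> g \in K -> ~~ adjacent_edges e g &
      forall e, e \in W -> e \notin K -> exists2 g, g \in K & dominated e g].

(** All neighbours of [e] in [W] have an arc into [e], so they can be discarded along with [e], and
    [e] added to a kernel of the rest. *)
Lemma stable_in_sink (W K : {set edge G}) (e : edge G) :
  e \in W -> {in W, forall g, adjacent_edges g e -> dominated g e} ->
  stable_in [set g in W | (g != e) && ~~ adjacent_edges g e] K ->
  stable_in W (e |: K).
Proof.
move=> eW sink [/subsetP KW indep dom]; split.
- apply/subsetP => g; rewrite !inE => /orP[/eqP->//|/KW].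
  by rewrite inE => /andP[].
- have nadj g : g \in K -> ~~ adjacent_edges g e.
    by move/KW; rewrite inE => /and3P[].
  move=> g h; rewrite !inE => /orP[/eqP->|gK] /orP[/eqP->|hK].
  + by rewrite /adjacent_edges eqxx.
  + by rewrite adjacent_edgesC nadj.
  + exact: nadj.
  + exact: indep.
- move=> g gW; rewrite !inE negb_or => /andP[ne gK].
  case: (boolP (adjacent_edges g e)) => [adj|nadj].
    by exists e; [rewrite !inE eqxx | apply: sink].
  have [|h hK gh] := dom g _ gK; first by rewrite inE gW ne.
  by exists h => //; rewrite !inE hK orbT.
Qed.

Definition crossing (e : edge G) : Prop :=
  exists x y, [/\ ends e = [set x; y], x \in D & y \notin D].

Lemma crossing_uniq (e : edge G) (x y : V) :
  crossing e -> x \in ends e -> y \in ends e -> (x \in D) = (y \in D) -> x = y.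
Proof.
move=> [a [b [-> aD bD]]]; rewrite !inE.
by do 2![case/orP=> /eqP->]; rewrite // aD (negPf bD).
Qed.

Lemma crossingVsub (e : edge G) :
  [\/ crossing e, ends e \subset D | ends e \subset ~: D].
Proof.
have /eqP/cards2P[x [y [_ E]]] := card_ends e.
rewrite E !subUset !sub1set !inE.
case: (boolP (x \in D)) => xD; case: (boolP (y \in D)) => yD /=.
- exact: Or32.
- by apply: Or31; exists x, y.
- by apply: Or31; exists y, x; rewrite setUC.
- exact: Or33.
Qed.

(** For a crossing edge: least colour in [W] at its end in [D], that is, the first choice of that
    end in stable-marriage terms. *)
Definition favourite (W : {set edge G}) (e : edge G) : bool :=
  (e \in W) && [forall g in W, [disjoint ends e :&: ends g & D] || (phi e <= phi g)].

Lemma favouriteP (W : {set edge G}) (e : edge G) :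
  reflect (e \in W /\ forall g x, g \in W -> x \in ends e -> x \in ends g ->
             x \in D -> phi e <= phi g)
          (favourite W e).
Proof.
apply: (iffP andP) => [[eW /forall_inP fav]|[eW fav]].
  split=> // g x gW xe xg xD; have /orP[dis|//] := fav g gW.
  by have := disjointFr dis (x := x); rewrite inE xe xg xD => /(_ isT).
split=> //; apply/forall_inP => g gW.
case: (boolP [disjoint _ & _]) => //=; rewrite -setI_eq0.
by case/set0Pn=> x; rewrite !inE => /andP[/andP[xe xg] xD]; apply: fav xD.
Qed.

(** Any other crossing edge has an arc, at its end in [D], to the favourite there; only independence
    has to be assumed. *)
Lemma stable_in_favourites (W : {set edge G}) :
  {in W, forall e, crossing e} ->
  (forall e g, favourite W e -> favourite W g -> ~~ adjacent_edges e g) ->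
  stable_in W [set e | favourite W e].
Proof.
move=> cross indep; split.
- by apply/subsetP => e; rewrite inE => /favouriteP[].
- by move=> e g; rewrite !inE; apply: indep.
move=> e eW; rewrite inE => nfav.
have [x [y [E xD yD]]] := cross e eW.
have xe : x \in ends e by rewrite E !inE eqxx.
pose P g := (g \in W) && (x \in ends g).
have Pe : P e by rewrite /P eW.
case: (arg_minnP phi Pe) => m /andP[mW xm] mmin.
have fm : favourite W m.
  apply/favouriteP; split=> // g z gW zm zg zD; apply: mmin.
  by rewrite /P gW (crossing_uniq (cross m mW) xm zm) ?zD.
exists m; first by rewrite inE.
apply/dominatedP; exists x; split; rewrite // /prefers xD ltn_neqAle mmin // andbT.
by apply: contraNneq nfav => /(colour_inj_at xm xe) <-.
Qed.

(* Galvin's step: if e1 is worse than the favourite e2 at a common end in U,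
   then any kernel of W minus e1 contains e2 or an edge better than e2 there. *)
Lemma stable_in_remove (W K : {set edge G}) (e1 e2 : edge G) :
  {in W, forall e, crossing e} -> favourite W e1 -> favourite W e2 ->
  adjacent_edges e1 e2 -> phi e1 < phi e2 ->
  stable_in (W :\ e1) K -> stable_in W K.
Proof.
move=> cross /favouriteP[e1W _] /favouriteP[e2W f2] /adjacent_edgesP[_ [y [y1 y2]]].
move=> lt12 [KW indep dom]; split=> //.
  by apply: subset_trans KW _; apply: subsetDl.
have yD : y \notin D.
  by apply/negP => yD; have := f2 e1 y e1W y2 y1 yD; rewrite leqNgt lt12.
move=> e eW eK; have [->|ne] := eqVneq e e1; last by apply: dom; rewrite // !inE ne.
case: (boolP (e2 \in K)) => [e2K|e2K].
  by exists e2 => //; apply/dominatedP; exists y; rewrite /prefers (negPf yD).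
have [|e3 e3K /dominatedP[z [z2 z3]]] := dom e2 _ e2K.
  by rewrite !inE e2W andbT; apply: contraTneq lt12 => ->; rewrite ltnn.
(* The arc from [e2] to [e3] cannot be at an end in [D], where [e2] has the least colour. So it is
   at [y], the only other end of [e2], and colours increase there along [e1], [e2], [e3]. *)
rewrite /prefers; case: ifPn => [zD lt32|zD lt23].
  have e3W : e3 \in W by move/subsetP: KW => /(_ _ e3K); rewrite !inE => /andP[].
  by have := f2 e3 z e3W z2 z3 zD; rewrite leqNgt lt32.
exists e3 => //; apply/dominatedP; exists y.
rewrite /prefers (negPf yD) (ltn_trans lt12 lt23); split=> //.
by rewrite (crossing_uniq (cross e2 e2W) y2 z2) // (negPf yD) (negPf zD).
Qed.

Hypothesis low_colours : forall e g,
  ends e \subset D -> ~~ (ends g \subset D) -> phi e < phi g.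
Hypothesis high_colours : forall e g,
  ends e \subset ~: D -> ~~ (ends g \subset ~: D) -> phi g < phi e.

(** The extremal colour is taken over all of [W]: by [low_colours] the minimum lies inside [D] as
    soon as some edge does, and dually for the maximum and [~: D]. *)
Lemma sink_or_crossing (W : {set edge G}) :
  (exists2 e, e \in W & {in W, forall g, adjacent_edges g e -> dominated g e}) \/
  {in W, forall e, crossing e}.
Proof.
case: (boolP [exists e in W, ends e \subset D]) => [/exists_inP[e eW eD]|noD].
  left; case: (arg_minnP phi eW) => m mW mmin; exists m => // g gW.
  have mD : ends m \subset D.
    by apply/negPn/negP => /(low_colours eD); rewrite ltnNge mmin.
  move/adjacent_edgesP=> [ne [x [xg xm]]]; apply/dominatedP; exists x; split=> //.
  rewrite /prefers (subsetP mD) // ltn_neqAle mmin // andbT.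
  by apply/eqP => /(colour_inj_at xm xg) /esym.
case: (boolP [exists e in W, ends e \subset ~: D]) => [/exists_inP[e eW eU]|noU].
  left; case: (arg_maxnP phi eW) => m mW mmax0; exists m => // g gW.
  have mmax h : h \in W -> phi h <= phi m by apply: mmax0.
  have mU : ends m \subset ~: D.
    by apply/negPn/negP => /(high_colours eU); rewrite ltnNge mmax.
  move/adjacent_edgesP=> [ne [x [xg xm]]]; apply/dominatedP; exists x; split=> //.
  have := subsetP mU x xm; rewrite inE /prefers => /negPf->.
  rewrite ltn_neqAle mmax // andbT.
  by apply/eqP => /(colour_inj_at xg xm).
right=> e eW; have [//|eD|eU] := crossingVsub e.
  by case/negP: noD; apply/exists_inP; exists e.
by case/negP: noU; apply/exists_inP; exists e.
Qed.

(** Induction on the size of [W]: strip a sink with its neighbours; failing that, drop the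
    smaller-coloured of two adjacent favourites; failing that, the favourites form a kernel. *)
Lemma exists_stable_in (W : {set edge G}) : exists K, stable_in W K.
Proof.
have [n] := ubnP #|W|; elim: n W => // n IH W ltWn.
have [[e eW sink]|cross] := sink_or_crossing W.
  have [|K stK] := IH [set g in W | (g != e) && ~~ adjacent_edges g e].
    rewrite -ltnS; apply: leq_trans _ ltWn; rewrite ltnS.
    apply/proper_card/properP; split.
      by apply/subsetP => g; rewrite inE => /andP[].
    by exists e; rewrite // inE eqxx andbF.
  by exists (e |: K); apply: stable_in_sink.
pose clash e g := [&& favourite W e, favourite W g & adjacent_edges e g].
case: (boolP [exists e, [exists g, clash e g]]) => [|noclash]; last first.
  exists [set e | favourite W e]; apply: stable_in_favourites => // e g fe fg.
  apply: contraNN noclash => adj.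
  by apply/existsP; exists e; apply/existsP; exists g; rewrite /clash fe fg.
case/existsP=> e /existsP[g /and3P[fe fg adj]].
wlog lt_eg : e g fe fg adj / phi e < phi g.
  move=> wl; have := colouring.2 e g adj; rewrite neq_ltn => /orP[|] lt.
    exact: wl lt.
  by apply: (wl g e) => //; rewrite adjacent_edgesC.
have [|K stK] := IH (W :\ e).
  by case/favouriteP: fe => eW _; move: ltWn; rewrite (cardsD1 e) eW add1n.
by exists K; exact: (stable_in_remove cross fe fg adj lt_eg stK).
Qed.

(** * Kernels and outdegrees of a Galvin orientation *)

Section Orientation.
Variable o : orientation (line_graph G).
Hypothesis galvin : galvin_orientation (~: D) D phi o.

Lemma mem_line_ends (a : line_edge G) (e : edge G) :
  e \in line_ends a -> incidence a \in ends e.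
Proof. by have /andP[_ /forall_inP] := valP a; apply. Qed.

Lemma line_ends_arc (a : line_edge G) :
  line_ends a = [set arc_tail o a; arc_head o a].
Proof. exact: (ends_arc o a). Qed.

Lemma incidence_tail (a : line_edge G) : incidence a \in ends (arc_tail o a).
Proof. by apply: mem_line_ends; rewrite line_ends_arc !inE eqxx. Qed.

Lemma incidence_head (a : line_edge G) : incidence a \in ends (arc_head o a).
Proof. by apply: mem_line_ends; rewrite line_ends_arc !inE eqxx orbT. Qed.

Lemma arc_prefers (a : line_edge G) :
  prefers (incidence a) (arc_head o a) (arc_tail o a).
Proof.
rewrite /prefers; case: ifPn => aD; first exact: (galvin a).1.
by apply: (galvin a).2; rewrite inE.
Qed.

Lemma prefers_arc (x : V) (e g : edge G) :
  x \in ends e -> x \in ends g -> prefers x g e ->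
  exists a, arc_tail o a = e /\ arc_head o a = g.
Proof.
move=> xe xg p; have ne : e != g.
  by apply: contraTneq p => ->; rewrite /prefers ltnn if_same.
have ok : (#|([set e; g], x).1| == 2) &&
    [forall h in ([set e; g], x).1, ([set e; g], x).2 \in ends h].
  rewrite /= cards2 ne; apply/forall_inP => h; rewrite !inE.
  by case/orP=> /eqP->.
pose a : line_edge G := exist _ ([set e; g], x) ok; exists a.
have E : [set e; g] = [set arc_tail o a; arc_head o a] by rewrite -line_ends_arc.
have := arc_prefers a; rewrite [incidence a]/=.
have : arc_tail o a \in [set e; g] by rewrite E !inE eqxx.
have : arc_head o a \in [set e; g] by rewrite E !inE eqxx orbT.
(* Tail [e] with head [g] is the goal; the other three cases contradict the strict colour
   comparisons. *)
rewrite !inE => /orP[/eqP-> | /eqP->] /orP[/eqP-> | /eqP->] //;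
  by move: p; rewrite /prefers; case: ifP => _; lia.
Qed.

Lemma galvin_kernel_perfect : kernel_perfect o.
Proof.
move=> W; have [K [KW indep dom]] := exists_stable_in W; exists K; split=> //.
- move=> a; apply/negP => /andP[tK hK]; apply/negP: (indep _ _ tK hK).
  apply/negPn/adjacent_edgesP; split; last first.
    by exists (incidence a); rewrite incidence_tail incidence_head.
  by move=> E; have := arc_prefers a; rewrite E /prefers ltnn if_same.
- move=> e; rewrite inE => /andP[eK eW].
  have [g gK /dominatedP[x [xe xg p]]] := dom e eW eK.
  by have [a [ta ha]] := prefers_arc xe xg p; exists a; rewrite ha.
Qed.

(** Arcs leaving [e] at [x] have heads of distinct colours, all below [phi e] if [x] is in [D] and
    all above it otherwise. *)
Lemma outdegree_at (e : edge G) (x : V) :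
  #|[set a | (arc_tail o a == e) && (incidence a == x)]|
    <= if x \in D then phi e - 1 else k - phi e.
Proof.
set A := [set a | _].
have AP a : a \in enum A -> arc_tail o a = e /\ incidence a = x.
  by rewrite mem_enum inE => /andP[/eqP-> /eqP->].
pose r := if x \in D then iota 1 (phi e - 1) else iota (phi e).+1 (k - phi e).
have -> : (if x \in D then phi e - 1 else k - phi e) = size r.
  by rewrite /r; case: ifP => _; rewrite size_iota.
rewrite cardE -(size_map (fun a => phi (arc_head o a))).
apply: uniq_leq_size.
  rewrite map_inj_in_uniq ?enum_uniq // => a b /AP[ta xa] /AP[tb xb] E.
  have hab : arc_head o a = arc_head o b.
    apply: (colour_inj_at (x := x)) E; first by rewrite -xa incidence_head.
    by rewrite -xb incidence_head.
  (* An edge of the line graph is determined by its two ends and its incidence. *)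
  apply/val_inj; rewrite [val a]surjective_pairing [val b]surjective_pairing.
  have := line_ends_arc a; have := line_ends_arc b.
  rewrite ta tb hab /line_ends => -> ->.
  by move: xa xb; rewrite /incidence => -> ->.
move=> c /mapP[a /AP[ta xa] ->]; have := arc_prefers a.
have := colouring.1 (arc_head o a).
rewrite ta xa /prefers /r; case: ifP => _; rewrite mem_iota; lia.
Qed.

Hypothesis low_half : forall e, ends e \subset D -> (phi e).*2 <= k.+1.
Hypothesis high_half : forall e, ends e \subset ~: D -> k.+1 <= (phi e).*2.

(** For a crossing edge the two ends contribute [(phi e - 1) + (k - phi e)]; for the others a single
    bound is doubled, whence the half-range hypotheses. *)
Lemma galvin_outdegree (e : edge G) : outdegree o e <= k - 1.
Proof.
have /eqP/cards2P[x [y [_ E]]] := card_ends e.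
pose A z := [set a | (arc_tail o a == e) && (incidence a == z)].
have sub : [set a | arc_tail o a == e] \subset A x :|: A y.
  apply/subsetP => a; rewrite !inE => ta; rewrite ta /=.
  by have := incidence_tail a; rewrite (eqP ta) E !inE.
apply: leq_trans (subset_leq_card sub) _.
apply: leq_trans (leq_card_setU _ _) _.
apply: leq_trans (leq_add (outdegree_at e x) (outdegree_at e y)) _.
have := colouring.1 e; have := low_half (e := e); have := high_half (e := e).
rewrite E !subUset !sub1set !inE.
by case: (x \in D); case: (y \in D) => /= high low;
  first [have := low isT; lia | have := high isT; lia | lia].
Qed.

End Orientation.

Lemma exists_galvin_orientation :
  exists o : orientation (line_graph G), galvin_orientation (~: D) D phi o.
Proof.
have /fin_all_exists[th thP] (a : line_edge G) : exists th : edge G * edge G,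
    line_ends a = [set th.1; th.2] /\ prefers (incidence a) th.2 th.1.
  have /andP[/cards2P[e [g [/eqP ne E]]] _] := valP a.
  have xe : incidence a \in ends e.
    by apply: mem_line_ends; rewrite /line_ends E !inE eqxx.
  have xg : incidence a \in ends g.
    by apply: mem_line_ends; rewrite /line_ends E !inE eqxx orbT.
  have : phi e != phi g by apply/eqP => /(colour_inj_at xe xg).
  rewrite neq_ltn => /orP[|] lt; case: (boolP (incidence a \in D)) => aD.
  - by exists (g, e); rewrite /prefers aD /line_ends E setUC.
  - by exists (e, g); rewrite /prefers (negPf aD).
  - by exists (e, g); rewrite /prefers aD.
  - by exists (g, e); rewrite /prefers (negPf aD) /line_ends E setUC.
exists (@Orientation _ (line_graph G) (fun a => (th a).1) (fun a => (th a).2)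
          (fun a => (thP a).1)) => a /=.
by have := (thP a).2; rewrite /prefers inE; case: (_ \in D).
Qed.

End GalvinOrientation.

Lemma proper_galvin_of_colouring (V : finType) (G : multigraph V) (D : {set V})
    (k : nat) (phi : edge G -> nat) :
  edge_colouring k phi ->
  (forall e g, ends e \subset D -> ~~ (ends g \subset D) -> phi e < phi g) ->
  (forall e g, ends e \subset ~: D -> ~~ (ends g \subset ~: D) -> phi g < phi e) ->
  (forall e, ends e \subset D -> (phi e).*2 <= k.+1) ->
  (forall e, ends e \subset ~: D -> k.+1 <= (phi e).*2) ->
  has_proper_galvin_orientation G k.
Proof.
move=> col low high lowh highh.
have [o go] := exists_galvin_orientation D col.
exists (~: D), D, phi, o; split=> //.
  by split; [rewrite setUC setUCr | rewrite -setI_eq0 setIC setICr].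
split; first exact: (galvin_kernel_perfect col low high go).
exact: (galvin_outdegree col go lowh highh).
Qed.

(** * The colouring of the complete graph *)

(* The round-robin colouring of the complete graph on {0, ..., 2s - 1}: the
   last vertex completes the near-perfect matchings i + j = c mod 2s - 1. *)
Definition round_robin (s i j : nat) : nat :=
  (if i == s.*2.-1 then j.*2 else if j == s.*2.-1 then i.*2 else i + j)
    %% s.*2.-1.

Lemma round_robinC (s i j : nat) :
  round_robin s i j = round_robin s j i.
Proof.
rewrite /round_robin addnC.
by case: eqP => [->|_]; case: eqP => // ->.
Qed.

Lemma round_robin_lt (s i j : nat) :
  i < s.*2 -> round_robin s i j < s.*2.-1.
Proof. by move=> lt; rewrite ltn_mod; lia. Qed.

(** Only the distance of [j] and [l] is bounded, because vertices outside [D] will be numbered from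
    [s.*2] on. *)
Lemma modn_addl_inj (p i j l : nat) :
  j < l + p -> l < j + p -> i + j = i + l %[mod p] -> j = l.
Proof.
wlog le_jl : j l / j <= l => [wl|_ lt] E.
  by have [le|/ltnW le] := leqP j l; [|symmetry]; apply: wl; rewrite ?E.
move: E => /esym/eqP; rewrite eqn_modDl eqn_mod_dvd // => /dvdn_leq; lia.
Qed.

(** At an ordinary vertex [i] the sums [i + j] miss only the residue of [i + i], which goes to the
    edge to the last vertex. At the last vertex the colours are doubles, distinct modulo an odd
    number. *)
Lemma round_robin_inj (s i j l : nat) :
  i < s.*2 -> j < s.*2 -> l < s.*2 -> i != j -> i != l ->
  round_robin s i j = round_robin s i l -> j = l.
Proof.
rewrite /round_robin => lis ljs lls ij il.
have [ip|ip] := eqVneq i; last first.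
  case: (eqVneq j) => jp; case: (eqVneq l) => lp.
  - by rewrite jp lp.
  - by rewrite -(addnn i) => /modn_addl_inj; lia.
  - by rewrite -(addnn i) => /modn_addl_inj; lia.
  - by move/modn_addl_inj; apply; lia.
have {}ljs : j < s.*2.-1 by lia.
have {}lls : l < s.*2.-1 by lia.
have odd_p : coprime s.*2.-1 2 by rewrite coprimen2; lia.
wlog le_jl : j l ij il ljs lls / j <= l.
  by move=> wl E; have [le|/ltnW le] := leqP j l; [|symmetry]; apply: wl => //; lia.
move=> /esym/eqP; rewrite eqn_mod_dvd ?leq_double //.
rewrite -doubleB -(muln2 (l - j)) Gauss_dvdl //.
by move/dvdn_leq; lia.
Qed.

(** [D] is the first [s.*2] vertices and [b] the maximum degree of the bipartite graph between the
    halves. The [uphalf] adds a dummy vertex to U when its size is odd. *)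
Definition split_colour (s n i j : nat) : nat :=
  let b := maxn s.*2 (n - s.*2) in
  if (i < s.*2) && (j < s.*2) then (round_robin s i j).+1
  else if (i < s.*2) || (j < s.*2) then s.*2 + (i + j) %% b
  else s.*2 + b + round_robin (uphalf (n - s.*2)) (i - s.*2) (j - s.*2).

Lemma split_colourC (s n i j : nat) : split_colour s n i j = split_colour s n j i.
Proof.
rewrite /split_colour andbC orbC (addnC i) (round_robinC s i).
by rewrite (round_robinC _ (i - _)).
Qed.

(** The three kinds of edges use consecutive intervals of colours, so the kind can be read off the
    colour. *)
Lemma split_colour_bounds (s n i j : nat) : i < n -> j < n ->
  let b := maxn s.*2 (n - s.*2) in
  let c := split_colour s n i j in
  [/\ 0 < c < s.*2 + b + (uphalf (n - s.*2)).*2.-1,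
      (c < s.*2) = (i < s.*2) && (j < s.*2) &
      (c < s.*2 + b) = (i < s.*2) || (j < s.*2)].
Proof.
move=> lin ljn; rewrite /split_colour.
have mod_lt m : 0 < s.*2 -> m %% maxn s.*2 (n - s.*2) < maxn s.*2 (n - s.*2).
  by move=> ?; rewrite ltn_mod; lia.
case: (ltnP i s.*2) => li; case: (ltnP j s.*2) => lj /=.
- by have := round_robin_lt j li; split; lia.
- by have := mod_lt (i + j); split; lia.
- by have := mod_lt (i + j); split; lia.
- have := @round_robin_lt (uphalf (n - s.*2)) (i - s.*2) (j - s.*2).
  by split; lia.
Qed.

Lemma split_colour_inj (s n i j l : nat) :
  i < n -> j < n -> l < n -> i != j -> i != l ->
  split_colour s n i j = split_colour s n i l -> j = l.
Proof.
move=> lin ljn lln ij il E.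
(* Equal colours give edges of the same kind; as they share [i], the other ends lie on the same
   side. *)
have Ed : (j < s.*2) = (l < s.*2).
  have [_ Ej Ej'] := split_colour_bounds s lin ljn.
  have [_] := split_colour_bounds s lin lln; rewrite -E Ej Ej'.
  by case: (i < _); case: (j < _); case: (l < _).
move: E; rewrite /split_colour -Ed.
case: (ltnP i s.*2) => li; case: (ltnP j s.*2) => lj /=.
- by case; apply: round_robin_inj => //; rewrite -Ed.
- move/addnI/modn_addl_inj; apply; lia.
- move/addnI/modn_addl_inj; apply; lia.
- have ll : s.*2 <= l by rewrite leqNgt -Ed; lia.
  move/addnI/round_robin_inj => H.
  have : j - s.*2 = l - s.*2 by apply: H; lia.
  lia.
Qed.

Lemma exists_edge_fun (V : finType) (c : V -> V -> nat) :
  (forall x y, c x y = c y x) ->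
  exists phi : edge (complete_graph V) -> nat,
    forall e x y, ends e = [set x; y] -> phi e = c x y.
Proof.
move=> cC.
have ex (e : edge (complete_graph V)) :
    exists m, forall x y, ends e = [set x; y] -> m = c x y.
  have /eqP/cards2P[x [y [ne ->]]] := card_ends e; exists (c x y) => z t E.
  have : z \in [set x; y] by rewrite E !inE eqxx.
  have : t \in [set x; y] by rewrite E !inE eqxx orbT.
  have : x \in [set z; t] by rewrite -E !inE eqxx.
  have : y \in [set z; t] by rewrite -E !inE eqxx orbT.
  rewrite !inE => Ey Ex /orP[]/eqP tE /orP[]/eqP zE; move: Ex Ey ne.
  - by rewrite tE zE !orbb => _ /eqP->; rewrite eqxx.
  - by rewrite tE zE cC.
  - by rewrite tE zE.
  - by rewrite tE zE !orbb => /eqP->; rewrite eqxx.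
exact: fin_all_exists ex.
Qed.

(** Here [s.*2] is an even number nearest to n/2. The first bound keeps all colours within [f n];
    the second puts the colours inside U in the upper half of the range. *)
Lemma f_bound (n s : nat) : 1 < n -> s = n.+2 %/ 4 ->
  s.*2 + maxn s.*2 (n - s.*2) + (uphalf (n - s.*2)).*2.-1 <= (f n).+1 /\
  f n <= (s.*2 + maxn s.*2 (n - s.*2)).*2.-1.
Proof.
move=> n1 ->; rewrite /f.
have := divn_eq n 4; have := ltn_pmod n (isT : 0 < 4).
case: (n %% 4) => [|[|[|[|]]]] //= _; lia.
Qed.

Theorem theorem6 (Delta : nat) (hDelta : 1 <= Delta) :
  has_proper_galvin_orientation (complete_graph 'I_Delta.+1) (f Delta.+1).
Proof.
set n := Delta.+1; pose s := n.+2 %/ 4.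
have [bound_hi bound_lo] := f_bound (hDelta : 1 < n) (erefl s).
have [|phi phiE] :=
  exists_edge_fun (c := fun i j : 'I_n => split_colour s n i j).
  by move=> i j; apply: split_colourC.
pose D := [set i : 'I_n | i < s.*2].
have subD (i j : 'I_n) : ([set i; j] \subset D) = (i < s.*2) && (j < s.*2).
  by rewrite subUset !sub1set !inE.
have subU (i j : 'I_n) :
    ([set i; j] \subset ~: D) = ~~ ((i < s.*2) || (j < s.*2)).
  by rewrite subUset !sub1set !inE negb_or.
have phiP e : let b := maxn s.*2 (n - s.*2) in
  [/\ 0 < phi e < s.*2 + b + (uphalf (n - s.*2)).*2.-1,
      (ends e \subset D) = (phi e < s.*2) &
      (ends e \subset ~: D) = (s.*2 + b <= phi e)].
  have /eqP/cards2P[i [j [_ E]]] := card_ends e.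
  have [? Elo Ehi] := split_colour_bounds s (ltn_ord i) (ltn_ord j).
  by rewrite (phiE e i j E) E subD subU -Elo -Ehi -leqNgt.
apply: (proper_galvin_of_colouring (D := D) (phi := phi)).
- split=> [e|e g]; first by have [] := phiP e; lia.
  case/andP=> neg /set0Pn[x]; rewrite inE => /andP[xe xg].
  (* Listing the common end [x] first reduces properness to injectivity of the colouring at [x]. *)
  have other (h : edge (complete_graph 'I_n)) :
      x \in ends h -> exists2 y, x != y & ends h = [set x; y].
    have /eqP/cards2P[y [z [ne ->]]] := card_ends h.
    rewrite !inE => /orP[]/eqP->; first by exists z.
    by exists y; rewrite 1?eq_sym // setUC.
  have [y xy Ee] := other e xe; have [z xz Eg] := other g xg.
  rewrite (phiE e x y Ee) (phiE g x z Eg); apply: contra neg => /eqP E.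
  apply/eqP/val_inj; rewrite -[val e]/(ends e) -[val g]/(ends g) Ee Eg.
  by congr [set _; _]; apply/val_inj; apply: split_colour_inj E.
- by move=> e g; have [_ -> _] := phiP e; have [_ -> _] := phiP g; lia.
- by move=> e g; have [_ _ ->] := phiP e; have [_ _ ->] := phiP g; lia.
(* The maximum is at least [s.*2], so [bound_hi] also bounds twice [s.*2] by [(f n).+1]. *)
- by move=> e; have [_ -> _] := phiP e; lia.
- by move=> e; have [_ _ ->] := phiP e; lia.
Qed.
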